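(* Let $k\ge 1$ be a fixed integer and suppose $p=p(n)$ satisfies $p^{k+1}n\to 0$ and $p^k n\to\infty$ as $n\to\infty$. Let $f_k$ be the number of $k$-dimensional faces of $X(n,p)$ and $\beta_k=\dim\widetilde H_k(X(n,p),\mathbb{Q})$. Then $E(\beta_k)/E(f_k)\to 1$. Moreover, almost always $\beta_k\sim E[\beta_k]$ and $f_k\sim E[f_k]$, so almost always $\beta_k\sim f_k$.
   Context: $G(n,p)$ is the random graph on vertex set $[n]$ with each edge included independently with probability $p$. The clique complex $X(H)$ of a graph $H$ is the simplicial complex whose faces are the vertex sets of complete subgraphs of $H$; $X(n,p)$ denotes $X(G(n,p))$. For random variables (or a random variable and a number) $X,Y$, ''$X\sim Y$ almost always'' means that for every $\epsilon>0$, $\Pr\big((1-\epsilon)\le Y/X\le(1+\epsilon)\big)\to 1$ as $n\to\infty$. ''Almost always'' means with probability tending to $1$ as $n\to\infty$. *)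

(* Defs.v *)
From mathcomp Require Import all_boot all_order all_algebra.
From mathcomp Require Import reals topology normedtype sequences.

Set Implicit Arguments.
Unset Strict Implicit.
Unset Printing Implicit Defensive.

Import Order.TTheory GRing.Theory Num.Theory.
Import numFieldNormedType.Exports.

Local Open Scope ring_scope.

Definition edge (n : nat) := {e : {set 'I_n} | #|e| == 2}.

Definition graph (n : nat) := {set edge n}.

Definition adj (n : nat) (G : graph n) (u v : 'I_n) : bool :=
  [exists e in G, val e == [set u; v]].

Definition is_clique (n : nat) (G : graph n) (s : {set 'I_n}) : bool :=
  [forall u in s, forall v in s, (u != v) ==> adj G u v].

(* The empty set is a face (of dimension -1): this is the augmentation which
   makes the homology below reduced. *)
Definition clique_complex (n : nat) (G : graph n) : {set {set 'I_n}} :=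
  [set s | is_clique G s].

Section Homology.
Variables (n : nat) (K : {set {set 'I_n}}).

(* The index m counts vertices: these faces have dimension m - 1. *)
Definition faces (m : nat) : {set {set 'I_n}} := [set s in K | #|s| == m].

Definition face_count (k : nat) : nat := #|faces k.+1|.

(* The coefficient of t in the boundary of s, for the orientation given by the
   order of 'I_n: if t = {v_0 < ... < v_k} minus v_i, it is (-1)^i. *)
Definition incidence (s t : {set 'I_n}) : rat :=
  \sum_(v in s | s :\ v == t) (-1) ^+ #|[set u in s | (u < v)%N]|.

(* The map from k-chains to (k-1)-chains, acting on row vectors. *)
Definition boundary (k : nat) : 'M[rat]_(#|faces k.+1|, #|faces k|) :=
  \matrix_(i, j) incidence (enum_val i) (enum_val j).

(* The quotient of the k-cycles by the k-boundaries, represented as a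
   complement of the boundaries in the cycles; by boundary_boundary, the
   boundaries are cycles whenever K is closed under taking subsets. *)
Definition homology (k : nat) : 'M[rat]_(#|faces k.+1|) :=
  (kermx (boundary k) :\: boundary k.+1)%MS.

Definition betti (k : nat) : nat := \rank (homology k).

Lemma boundary_boundary (k : nat) :
  (forall s t : {set 'I_n}, t \subset s -> s \in K -> t \in K) ->
  boundary k.+1 *m boundary k = 0.
Proof.
move=> closedK; apply/matrixP => i j; rewrite !mxE.
set s := enum_val i; set t := enum_val j.
pose N (r : {set 'I_n}) (v : 'I_n) := #|[set u in r | (u < v)%N]|.
pose F (v w : 'I_n) : rat :=
  if [&& v \in s, w \in s, v != w & s :\ v :\ w == t]
  then (-1) ^+ (N s v + N (s :\ v) w) else 0.
have /andP[sK /eqP cs] : (s \in K) && (#|s| == k.+2).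
  by have := enum_valP i; rewrite inE.
have step (v : 'I_n) : v \in s -> s :\ v \in faces k.+1.
  move=> vs; rewrite inE (closedK s) ?subD1set //=.
  by have := cardsD1 v s; rewrite vs cs add1n => -[<-].
have -> : \sum_(l < #|faces k.+1|)
    boundary k.+1 i l * boundary k l j = \sum_v \sum_w F v w.
  under eq_bigr do rewrite !mxE -/s -/t.
  rewrite -(big_enum_val (A := mem (faces k.+1))
    (fun r => incidence s r * incidence r t)) /=.
  under eq_bigr do rewrite {1}/incidence mulr_suml.
  rewrite (exchange_big_dep (mem s)) /=; last by move=> r v _ /andP[].
  rewrite [RHS](bigID (mem s)) /= [X in _ = _ + X]big1 ?addr0; last first.
    by move=> v /negbTE vs; apply: big1 => w _; rewrite /F vs.
  apply: eq_bigr => v vs; rewrite (big_pred1 (s :\ v)); last first.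
    move=> r /=; rewrite vs /= eq_sym; case: eqP => [->|]; last by rewrite andbF.
    by rewrite step.
  rewrite /incidence mulr_sumr [LHS]big_mkcond; apply: eq_bigr => w _.
  by rewrite /F vs /= in_setD1 [v == w]eq_sym -andbA andbCA exprD.
have NE (v w : 'I_n) : v \in s -> N s w = (N (s :\ v) w + (v < w))%N.
  move=> vs; rewrite /N (cardsD1 v) inE vs /= addnC; congr (_ + _)%N.
  by apply: eq_card => u; rewrite !inE andbA.
have Fanti (v w : 'I_n) : F v w = - F w v.
  rewrite /F [w == v]eq_sym.
  have -> : s :\ w :\ v = s :\ v :\ w by rewrite !setDDl setUC.
  case vs: (v \in s); case ws: (w \in s); rewrite ?oppr0 //=.
  case: eqVneq => [|nvw] /=; first by rewrite oppr0.
  case: ifP; rewrite ?oppr0 // => _.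
  rewrite (NE w v ws) (NE v w vs) -(signr_odd _ (_ + _ + _)).
  rewrite -[in RHS]signr_odd !oddD -signrN.
  by case: ltngtP nvw => [|| /ord_inj ->]; rewrite ?eqxx //= => _ _;
     case: (odd _); case: (odd _).
have S0 : \sum_v \sum_w F v w = - \sum_v \sum_w F v w.
  rewrite {1}exchange_big /= -sumrN; apply: eq_bigr => v _.
  by rewrite -sumrN; apply: eq_bigr => w _; rewrite Fanti.
have /eqP : (\sum_v \sum_w F v w) *+ 2 = 0 by rewrite mulr2n {1}S0 addNr.
by rewrite mulrn_eq0 => /eqP.
Qed.

End Homology.

Lemma clique_complex_closed (n : nat) (G : graph n) (s t : {set 'I_n}) :
  t \subset s -> s \in clique_complex G -> t \in clique_complex G.
Proof.
move=> /subsetP ts; rewrite !inE => /forall_inP cs.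
apply/forall_inP => u /ts us; apply/forall_inP => v /ts.
by move: v; apply/forall_inP; apply: cs.
Qed.

Section RandomGraph.
Variables (R : realType) (n : nat) (p : R).

(* The probability of the outcome G in G(n,p). *)
Definition Gnp (G : graph n) : R :=
  \prod_(e : edge n) (if e \in G then p else 1 - p).

Definition Pr (A : pred (graph n)) : R := \sum_(G | A G) Gnp G.

Definition Ex (X : graph n -> R) : R := \sum_G Gnp G * X G.

Definition f_ (k : nat) (G : graph n) : R :=
  (face_count (clique_complex G) k)%:R.

Definition beta_ (k : nat) (G : graph n) : R :=
  (betti (clique_complex G) k)%:R.

End RandomGraph.

Arguments f_ R {n} k G.
Arguments beta_ R {n} k G.

Local Open Scope classical_set_scope.

(* X ~ Y almost always, for random variables on G(n, p n); a number is the
   corresponding constant random variable. Where X vanishes the quotient is 0,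
   so that the event fails as soon as eps < 1. *)
Definition sim_aa (R : realType) (p : nat -> R)
    (X Y : forall n : nat, graph n -> R) : Prop :=
  forall eps : R, 0 < eps ->
    (fun n => Pr (p n) (fun G : graph n =>
        1 - eps <= Y n G / X n G <= 1 + eps)) @ \oo --> (1 : R).

(* Main.v *)
(* Since beta_k = dim Z_k - dim B_k, counting dimensions gives
   f_k - f_{k-1} - f_{k+1} <= beta_k <= f_k.  As E f_j = C(n,j+1) p^C(j+1,2),
   the ratios E f_{k+1} / E f_k <= n p^{k+1} and E f_{k-1} / E f_k = O(1/(n p^k))
   tend to 0, so E(f_k - beta_k) = o(E f_k).  Two (k+1)-sets s, t sharing m
   vertices are both cliques with probability p^(2C(k+1,2) - C(m,2)); only m >= 2
   contributes to the variance, and summing over s :&: t gives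
   Var f_k = O((E f_k)^2 / (n p^k)).  Chebyshev for f_k and Markov for
   f_k - beta_k put both f_k and beta_k in a small window around E f_k. *)
Require Import Defs.
From mathcomp Require Import all_boot all_order all_algebra.
From mathcomp Require Import reals topology normedtype sequences.
From mathcomp Require Import ring lra zify.

Import Order.TTheory GRing.Theory Num.Theory.
Import numFieldNormedType.Exports.

Local Open Scope ring_scope.

Set Implicit Arguments.
Unset Strict Implicit.

(** * Linear algebra: Betti numbers against face counts *)

Lemma betti_le_face_count n (K : {set {set 'I_n}}) k :
  (betti K k <= face_count K k)%N.
Proof. exact: rank_leq_row. Qed.

(** By rank-nullity the cycles have dimension [face_count K k] minus the rank of [boundary K k], a
    rank bounded by its number of columns. The complement then loses at most the rank of
    [boundary K k.+1], bounded by its number of rows. *)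
Lemma face_count_le_betti n (K : {set {set 'I_n}}) k :
  (face_count K k <= betti K k + (#|faces K k| + #|faces K k.+2|))%N.
Proof.
rewrite /betti /homology /face_count.
have := mxrank_cap_compl (kermx (boundary K k)) (boundary K k.+1).
have := mxrankS (capmxSr (kermx (boundary K k)) (boundary K k.+1)).
rewrite mxrank_ker.
have := rank_leq_col (boundary K k); have := rank_leq_row (boundary K k.+1).
lia.
Qed.

(** * Edge sets of cliques and binomial estimates *)

Definition edges_in n (s : {set 'I_n}) : {set edge n} :=
  [set e : edge n | val e \subset s].

(** Turns the clique event into the inclusion of a fixed edge set, whose probability is a power of
    [p]. *)
Lemma is_cliqueE n (G : graph n) s : is_clique G s = (edges_in s \subset G).
Proof.
apply/forall_inP/subsetP => [cl e | sub u us].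
  rewrite inE => es; have /cards2P[u [v [uv ev]]] := valP e.
  move: es; rewrite ev subUset !sub1set => /andP[us vs].
  have /forall_inP/(_ v vs) := cl u us; rewrite uv => /exists_inP[e' e'G].
  by rewrite -ev => /eqP/val_inj <-.
apply/forall_inP => v vs; apply/implyP => uv.
have c2 : #|[set u; v]| == 2 by rewrite cards2 uv.
apply/exists_inP; exists (Sub [set u; v] c2); last by rewrite SubK.
by apply: sub; rewrite inE SubK subUset !sub1set us.
Qed.

Lemma card_edges_in n (s : {set 'I_n}) : #|edges_in s| = 'C(#|s|, 2).
Proof.
rewrite -cards_draws -(card_imset _ val_inj); apply: eq_card => e.
apply/imsetP/idP => [[e' + ->]|]; rewrite !inE.
  by move=> ->; rewrite (valP e').
by move=> /andP[es e2]; exists (Sub e e2); rewrite ?inE SubK.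
Qed.

(** Inclusion-exclusion: the common edges are exactly those inside [s :&: t]. *)
Lemma card_edges_inU n (s t : {set 'I_n}) :
  (#|edges_in s :|: edges_in t| + 'C(#|s :&: t|, 2) =
   'C(#|s|, 2) + 'C(#|t|, 2))%N.
Proof.
have -> : 'C(#|s :&: t|, 2) = #|edges_in s :&: edges_in t|.
  by rewrite -card_edges_in; apply: eq_card => e; rewrite !inE subsetI.
by rewrite cardsUI !card_edges_in.
Qed.

(** Removing [u] is injective on the supersets of [u]. *)
Lemma card_draws_over n j (u : {set 'I_n}) :
  (#|[set t : {set 'I_n} | (u \subset t) && (#|t| == j)]| <= 'C(n, j - #|u|))%N.
Proof.
rewrite -(card_in_imset (f := fun t => t :\: u)).
  have := card_draws 'I_n (j - #|u|)%N; rewrite card_ord => <-.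
  apply/subset_leq_card/subsetP => _ /imsetP[t + ->].
  rewrite !inE => /andP[ut /eqP <-].
  by rewrite cardsD (setIidPr ut).
move=> t t'; rewrite !inE => /andP[ut _] /andP[ut' _] E.
by rewrite -(setID t u) -(setID t' u) E !(setIidPr _).
Qed.

(** Each step down from i <= c costs a factor 2c/n, because i C(n,i) = (n-i+1) C(n,i-1) and n-i+1 >=
    n/2. *)
Lemma bin_shift n j c m : (j <= c)%N -> (2 * c <= n)%N -> (m <= j)%N ->
  ('C(n, j - m) * n ^ m <= (2 * c) ^ m * 'C(n, j))%N.
Proof.
move=> jc cn; elim: m => [|m IH] mj; first by rewrite subn0 muln1 mul1n.
have := IH (ltnW mj).
have := mul_bin_left n (j - m.+1).
have -> : (j - m.+1).+1 = (j - m)%N by lia.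
move=> E le1; rewrite !expnS.
have le2 : ('C(n, j - m.+1) * n <= 2 * c * 'C(n, j - m))%N by nia.
apply: (@leq_trans (2 * c * 'C(n, j - m) * n ^ m)%N).
  by rewrite mulnA leq_mul2r le2 orbT.
by rewrite -(mulnA (2 * c)) -[leqRHS]mulnA leq_mul2l le1 orbT.
Qed.

(** * Expectation and probability on G(n,p) *)

Section RandomGraph.
Variables (R : realType) (n : nat) (p : R).
Hypothesis p01 : 0 <= p <= 1.

Lemma Gnp_ge0 (G : graph n) : 0 <= Gnp p G.
Proof.
by case/andP: p01 => p0 p1; apply: prodr_ge0 => e _; case: ifP; rewrite ?subr_ge0.
Qed.

(** Expanding the product of the two-term sums over all edges gives one term per graph, and this
    term vanishes as soon as [G] misses an edge of [T]. Edges outside [T] contribute the factor p +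
    (1 - p) = 1. *)
Lemma Pr_subset (T : {set edge n}) :
  Ex p (fun G => (T \subset G)%:R) = p ^+ #|T|.
Proof.
transitivity (\prod_(e : edge n) (p + (if e \in T then 0 else 1 - p))).
  rewrite bigA_distr; apply: eq_bigr => G _; case: (boolP (T \subset G)) => TG.
    rewrite mulr1; apply: eq_bigr => e _; case: ifPn => // eG.
    by rewrite ifN //; apply: contra eG; apply/subsetP.
  have /subsetPn[e eT eG] := TG.
  by rewrite mulr0 (bigD1 e) //= (negbTE eG) eT mul0r.
rewrite (bigID (mem T)) /= [X in _ * X]big1 ?mulr1; last first.
  by move=> e /negbTE ->; rewrite addrC subrK.
rewrite -prodr_const; apply: eq_bigr => e ->; exact: addr0.
Qed.

Lemma Ex_cst (a : R) : Ex p (fun _ : graph n => a) = a.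
Proof.
rewrite /Ex -mulr_suml -[RHS]mul1r; congr (_ * _).
have := Pr_subset set0; rewrite cards0 expr0 => <-.
by apply: eq_bigr => G _; rewrite sub0set mulr1.
Qed.

Lemma ExD (X Y : graph n -> R) :
  Ex p (fun G => X G + Y G) = Ex p X + Ex p Y.
Proof. by rewrite -big_split; apply: eq_bigr => G _; rewrite mulrDr. Qed.

Lemma ExB (X Y : graph n -> R) :
  Ex p (fun G => X G - Y G) = Ex p X - Ex p Y.
Proof. by rewrite -sumrB; apply: eq_bigr => G _; rewrite mulrBr. Qed.

Lemma ExZ (a : R) (X : graph n -> R) : Ex p (fun G => a * X G) = a * Ex p X.
Proof. by rewrite mulr_sumr; apply: eq_bigr => G _; rewrite mulrCA. Qed.

Lemma Ex_sum (I : finType) (P : pred I) (X : I -> graph n -> R) :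
  Ex p (fun G => \sum_(i | P i) X i G) = \sum_(i | P i) Ex p (X i).
Proof. by rewrite exchange_big; apply: eq_bigr => G _; rewrite mulr_sumr. Qed.

Lemma ler_Ex (X Y : graph n -> R) :
  (forall G, X G <= Y G) -> Ex p X <= Ex p Y.
Proof. by move=> XY; apply: ler_sum => G _; rewrite ler_wpM2l ?Gnp_ge0. Qed.

Lemma eq_Ex (X Y : graph n -> R) : X =1 Y -> Ex p X = Ex p Y.
Proof. by move=> XY; apply: eq_bigr => G _; rewrite XY. Qed.

Lemma Pr_Ex (A : pred (graph n)) : Pr p A = Ex p (fun G => (A G)%:R).
Proof.
rewrite /Pr big_mkcond; apply: eq_bigr => G _.
by case: (A G); rewrite ?mulr1 ?mulr0.
Qed.

Lemma Pr_le1 (A : pred (graph n)) : Pr p A <= 1.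
Proof. by rewrite Pr_Ex -[leRHS]Ex_cst ler_Ex // => G; case: (A G). Qed.

(** Pointwise, 1 is at most the indicator of [A] plus [Y]. With [Y] a sum of two penalties, this
    yields Chebyshev and Markov at once. *)
Lemma markov_compl (A : pred (graph n)) (Y : graph n -> R) :
  (forall G, 0 <= Y G) -> (forall G, ~~ A G -> 1 <= Y G) ->
  1 - Ex p Y <= Pr p A.
Proof.
move=> Y0 Y1; rewrite Pr_Ex lerBlDr -ExD -[leLHS]Ex_cst.
apply: ler_Ex => G; case: (boolP (A G)) => [_|/Y1]; last by rewrite add0r.
by rewrite lerDl.
Qed.

Lemma sub_Pr (A B : pred (graph n)) :
  (forall G, A G -> B G) -> Pr p A <= Pr p B.
Proof.
move=> AB; rewrite !Pr_Ex; apply: ler_Ex => G; rewrite ler_nat.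
by case: (boolP (A G)) => // /AB ->.
Qed.

(** * First and second moments of face counts *)

Lemma card_facesE (m : nat) (G : graph n) :
  #|faces (clique_complex G) m|%:R =
  \sum_(s : {set 'I_n} | #|s| == m) (edges_in s \subset G)%:R :> R.
Proof.
rewrite -sum1_card natr_sum [RHS]big_mkcond [LHS]big_mkcond /=.
apply: eq_bigr => s _; rewrite !inE is_cliqueE andbC.
by case: (_ == _); case: (_ \subset _).
Qed.

Lemma Ex_card_faces (m : nat) :
  Ex p (fun G : graph n => #|faces (clique_complex G) m|%:R) =
  'C(n, m)%:R * p ^+ 'C(m, 2).
Proof.
rewrite (eq_Ex (card_facesE m)) Ex_sum.
under eq_bigr => s /eqP sm do rewrite Pr_subset card_edges_in sm.
by have := card_draws 'I_n m; rewrite card_ord cardsE sumr_const mulr_natl => ->.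
Qed.

Lemma Ex_f (k : nat) :
  Ex p (@f_ R n k) = 'C(n, k.+1)%:R * p ^+ 'C(k.+1, 2).
Proof. exact: Ex_card_faces. Qed.

Lemma Ex_card_faces_sqr (m : nat) :
  Ex p (fun G : graph n => #|faces (clique_complex G) m|%:R ^+ 2) =
  \sum_(s : {set 'I_n} | #|s| == m) \sum_(t : {set 'I_n} | #|t| == m)
     p ^+ ('C(m, 2) + 'C(m, 2) - 'C(#|s :&: t|, 2)).
Proof.
under eq_Ex do rewrite card_facesE expr2 mulr_suml.
rewrite Ex_sum; apply: eq_bigr => s /eqP sm.
under eq_Ex do rewrite mulr_sumr.
rewrite Ex_sum; apply: eq_bigr => t /eqP tm.
under eq_Ex do rewrite -natrM mulnb -subUset.
have := card_edges_inU s t; rewrite sm tm => <-.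
by rewrite addnK Pr_subset.
Qed.

(** * Quantitative bounds for fixed n, with error parameter [w] *)

Section Sparse.
(* Asymptotically, w = 2(k+1)/(n p^k), which tends to 0. *)
Variables (k : nat) (w : R).
Hypothesis w01 : 0 <= w <= 1.
Hypothesis np_large : (2 * k.+1)%:R <= w * (p ^+ k * n%:R).

Lemma np_large_card : (2 * k.+1 <= n)%N.
Proof.
case/andP: p01 w01 => p0 p1 /andP[w0 w1]; rewrite -(ler_nat R).
apply: le_trans np_large _; rewrite mulrA ler_piMl ?mulr_ile1 ?exprn_ge0 //.
by rewrite exprn_ile1.
Qed.

(** This is [bin_shift] with j = c = k+1, divided by n^m; [np_large] bounds 2(k+1)/n by w p^k. *)
Lemma bin_ratio m : (m <= k.+1)%N ->
  'C(n, k.+1 - m)%:R <= (w * p ^+ k) ^+ m * 'C(n, k.+1)%:R :> R.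
Proof.
move=> mk; have nk := np_large_card.
have n0 : 0 < n%:R :> R by rewrite ltr0n; lia.
rewrite -(ler_pM2r (exprn_gt0 m n0)).
rewrite mulrAC -exprMn -mulrA -natrX -natrM.
apply: (@le_trans _ _ ((2 * k.+1) ^ m * 'C(n, k.+1))%:R).
  by rewrite ler_nat bin_shift.
by rewrite natrM natrX ler_wpM2r ?ler0n // lerXn2r ?nnegrE ?(le_trans _ np_large).
Qed.

(** Here w^m <= w, and p^(km) <= p^C(m,2) because m - 1 <= k. The factor p^C(m,2) offsets the gain
    in probability from m shared vertices. *)
Lemma bin_ratio_p m : (2 <= m <= k.+1)%N ->
  'C(n, k.+1 - m)%:R <= w * p ^+ 'C(m, 2) * 'C(n, k.+1)%:R :> R.
Proof.
case/andP: p01 w01 => p0 p1 /andP[w0 w1] /andP[m2 mk].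
apply: le_trans (bin_ratio mk) _; rewrite ler_wpM2r // exprMn.
apply: ler_pM; rewrite ?exprn_ge0 //; first by rewrite ler_iXnr //; lia.
rewrite -exprM ler_wiXn2l // -(leq_pmul2l (isT : (0 < 2)%N)) bin2.
have := half_leq (leqnn (m * m.-1)); nia.
Qed.

Lemma Ex_f_sqr :
  Ex p (fun G : graph n => f_ R k G ^+ 2) <=
  (1 + 2 ^+ k.+1 * w) * Ex p (@f_ R n k) ^+ 2.
Proof.
case/andP: p01 w01 => p0 p1 /andP[w0 w1].
rewrite Ex_f Ex_card_faces_sqr; set c := 'C(k.+1, 2); set M := 'C(n, k.+1).
have card_k : #|[pred s : {set 'I_n} | #|s| == k.+1]| = M.
  by have := card_draws 'I_n k.+1; rewrite card_ord cardsE.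
suff inner (s : {set 'I_n}) : #|s| == k.+1 ->
    \sum_(t : {set 'I_n} | #|t| == k.+1) p ^+ (c + c - 'C(#|s :&: t|, 2)) <=
    (1 + 2 ^+ k.+1 * w) * (M%:R * p ^+ (c + c)).
  apply: le_trans (ler_sum _ inner) _.
  rewrite sumr_const card_k -mulr_natl exprD; set W := _ * w.
  by rewrite le_eqVlt; apply/orP; left; apply/eqP; ring.
move=> /eqP sk.
(* The size of [s :&: t] is replaced by a sum over all candidates u for this intersection, so that
   the sum over t only has to count supersets of u. *)
pose U (u : {set 'I_n}) := (u \subset s) && (2 <= #|u|)%N.
have bnd (t : {set 'I_n}) : p ^+ (c + c - 'C(#|s :&: t|, 2)) <= p ^+ (c + c) +
    \sum_(u | U u) (u \subset t)%:R * p ^+ (c + c - 'C(#|u|, 2)).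
  have S0 (P : pred {set 'I_n}) :
      0 <= \sum_(u | P u) (u \subset t)%:R * p ^+ (c + c - 'C(#|u|, 2)).
    by apply: sumr_ge0 => u _; rewrite mulr_ge0 ?exprn_ge0.
  (* The term u = [s :&: t] alone suffices; with at most one common vertex the binomial is 0 and the
     first summand suffices. *)
  case: (leqP 2 #|s :&: t|) => st; last by rewrite bin_small // subn0 lerDl.
  rewrite (bigD1 (s :&: t)) /= /U ?subsetIl // subsetIr mul1r addrCA lerDl.
  by rewrite addr_ge0 ?exprn_ge0.
apply: le_trans (ler_sum _ (fun t _ => bnd t)) _.
rewrite big_split /= sumr_const card_k mulrDl mul1r -[X in X + _]mulr_natl lerD2l.
rewrite exchange_big /=.
(* Every u contributes at most the same amount, and [s] has 2^(k+1) subsets. *)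
apply: (@le_trans _ _ (\sum_(u in powerset s) w * (M%:R * p ^+ (c + c)))); last first.
  by rewrite sumr_const card_powerset sk -[leLHS]mulr_natl natrX mulrA.
rewrite [leRHS](bigID (fun u : {set 'I_n} => (2 <= #|u|)%N)) /=.
apply: ler_wpDr; first by apply: sumr_ge0 => u _; rewrite !mulr_ge0 ?exprn_ge0.
rewrite [leRHS](eq_bigl U) => [|u]; last by rewrite /= powersetE.
apply: ler_sum => u /andP[us u2].
have uk : (#|u| <= k.+1)%N by rewrite -sk subset_leq_card.
(* The exponent uses truncated subtraction; this bound lets p^(c+c) be factored without dividing by
   [p], which may be 0. *)
have cu : ('C(#|u|, 2) <= c + c)%N.
  by rewrite (leq_trans (leq_bin2l 2 uk)) ?leq_addr.
rewrite -mulr_suml; set q := p ^+ (c + c - _).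
have -> : p ^+ (c + c) = p ^+ 'C(#|u|, 2) * q by rewrite -exprD subnKC.
rewrite !mulrA ler_wpM2r ?exprn_ge0 // mulrAC.
apply: le_trans (bin_ratio_p _); last by rewrite u2.
rewrite -natr_sum ler_nat (leq_trans _ (card_draws_over k.+1 u)) //.
rewrite -sum1_card big_mkcond [leqRHS]big_mkcond leq_sum // => t _.
by rewrite inE; case: (_ == _); case: (_ \subset _).
Qed.

(** Faces one dimension up cost n p^(k+1), from C(n,k+2) <= n C(n,k+1) and k+1 extra edges. Faces
    one dimension down cost [w], from [bin_ratio] at m = 1 and k fewer edges. *)
Lemma Ex_f_sub_beta :
  Ex p (fun G : graph n => f_ R k G - beta_ R k G) <=
  (p ^+ k.+1 * n%:R + w) * Ex p (@f_ R n k).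
Proof.
case/andP: p01 w01 => p0 p1 /andP[w0 w1].
apply: (@le_trans _ _ (Ex p (fun G : graph n =>
    #|faces (clique_complex G) k.+2|%:R + #|faces (clique_complex G) k|%:R))).
  apply: ler_Ex => G; rewrite lerBlDl addrC -!natrD ler_nat.
  by have := face_count_le_betti (clique_complex G) k; lia.
rewrite ExD Ex_f !Ex_card_faces mulrDl; apply: lerD.
  have binle : 'C(n, k.+2)%:R <= n%:R * 'C(n, k.+1)%:R :> R.
    by rewrite -natrM ler_nat; have := mul_bin_left n k.+1; nia.
  rewrite [in X in p ^+ X]binS bin1 exprD.
  set a := p ^+ _; set b := p ^+ k.+1.
  have -> (c d : R) : b * c * (d * a) = c * d * (a * b) by ring.
  by rewrite ler_wpM2r ?mulr_ge0 ?exprn_ge0.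
have := @bin_ratio 1 isT; rewrite subn1 expr1 /= => binle.
rewrite [in X in _ * (_ * p ^+ X)]binS bin1 exprD.
have -> (a b c : R) : w * (a * (b * c)) = w * c * a * b by ring.
by rewrite ler_wpM2r ?exprn_ge0.
Qed.

Lemma Pr_concentration delta :
  0 < delta -> 0 < Ex p (@f_ R n k) ->
  1 - (2 ^+ k.+1 * w / delta ^+ 2 + (p ^+ k.+1 * n%:R + w) / delta) <=
  Pr p (fun G : graph n =>
    (`|f_ R k G - Ex p (@f_ R n k)| <= delta * Ex p (@f_ R n k)) &&
    (f_ R k G - beta_ R k G <= delta * Ex p (@f_ R n k))).
Proof.
set mu := Ex p (@f_ R n k) => d0 mu0.
have dmu0 : 0 < delta * mu by rewrite mulr_gt0.
have fb0 (G : graph n) : 0 <= f_ R k G - beta_ R k G.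
  by rewrite subr_ge0 ler_nat betti_le_face_count.
(* A Chebyshev penalty plus a Markov penalty: each is nonnegative, and at least 1 when its half of
   the event fails. *)
pose Y (G : graph n) := (delta * mu) ^- 2 * (f_ R k G - mu) ^+ 2 +
  (delta * mu)^-1 * (f_ R k G - beta_ R k G).
have t1 (G : graph n) : 0 <= (delta * mu) ^- 2 * (f_ R k G - mu) ^+ 2.
  by rewrite mulr_ge0 ?sqr_ge0 // invr_ge0 exprn_ge0 // ltW.
have t2 (G : graph n) : 0 <= (delta * mu)^-1 * (f_ R k G - beta_ R k G).
  by rewrite mulr_ge0 // invr_ge0 ltW.
apply: le_trans (markov_compl (Y := Y) _ _); last 2 first.
- by move=> G; rewrite addr_ge0.
- move=> G; rewrite negb_and -!ltNge => /orP[h|h].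
    rewrite ler_wpDr //; rewrite mulrC ler_pdivlMr ?exprn_gt0 // mul1r.
    by rewrite -(real_normK (num_real (f_ R k G - mu))) lerXn2r ?nnegrE // ltW.
  by rewrite ler_wpDl // mulrC ler_pdivlMr // mul1r ltW.
rewrite lerD2l lerN2 ExD !ExZ; apply: lerD; last first.
  rewrite mulrC ler_pdivrMr // mulrA divfK ?gt_eqF //; exact: Ex_f_sub_beta.
have -> : Ex p (fun G : graph n => (f_ R k G - mu) ^+ 2) =
    Ex p (fun G : graph n => f_ R k G ^+ 2) - mu ^+ 2.
  under eq_Ex => G.
    rewrite (_ : _ ^+ 2 = f_ R k G ^+ 2 + (- (2 * mu) * f_ R k G + mu ^+ 2)); last by ring.
    over.
  by rewrite !ExD ExZ Ex_cst -/mu; ring.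
rewrite mulrC ler_pdivrMr ?exprn_gt0 // exprMn mulrA divfK ?expf_neq0 ?gt_eqF //.
by have := Ex_f_sqr; rewrite -/mu mulrDl mul1r lerBlDl.
Qed.

End Sparse.
End RandomGraph.

(** * Passage to the limit *)

Lemma ratio_close (R : realFieldType) (eps delta mu x y : R) :
  0 < mu -> 0 < delta <= 10^-1 -> 10 * delta <= eps ->
  (1 - 2 * delta) * mu <= x <= (1 + delta) * mu ->
  (1 - 2 * delta) * mu <= y <= (1 + delta) * mu ->
  1 - eps <= y / x <= 1 + eps.
Proof.
move=> mu0 /andP[d0 d1] de /andP[x1 x2] /andP[y1 y2].
have x0 : 0 < x by apply: lt_le_trans x1; rewrite mulr_gt0 //; lra.
rewrite ler_pdivlMr // ler_pdivrMr //; apply/andP; split.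
  have h : (1 - eps) * x <= (1 - 10 * delta) * x.
    by rewrite ler_wpM2r ?(ltW x0) //; lra.
  by apply: (le_trans h); apply: le_trans y1; nra.
have h : (1 + 10 * delta) * x <= (1 + eps) * x.
  by rewrite ler_wpM2r ?(ltW x0) //; lra.
by apply: le_trans h; apply: (le_trans y2); nra.
Qed.

Local Open Scope classical_set_scope.

Theorem theorem3p8 (R : realType) (k : nat) (p : nat -> R)
    (hk : (1 <= k)%N)
    (hp : forall n : nat, 0 <= p n <= 1)
    (hp0 : (fun n : nat => p n ^+ k.+1 * n%:R) @ \oo --> (0 : R))
    (hpoo : (fun n : nat => p n ^+ k * n%:R) @ \oo --> +oo) :
  [/\ (fun n : nat => Ex (p n) (@beta_ R n k) / Ex (p n) (@f_ R n k))
        @ \oo --> (1 : R),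
      sim_aa p (fun n => @beta_ R n k)
               (fun n _ => Ex (p n) (@beta_ R n k)),
      sim_aa p (fun n => @f_ R n k)
               (fun n _ => Ex (p n) (@f_ R n k)) &
      sim_aa p (fun n => @beta_ R n k) (fun n => @f_ R n k)].
Proof.
pose mu n := Ex (p n) (@f_ R n k).
(* The choice of [w] that makes [np_large] an equality. *)
pose w n : R := (2 * k.+1)%:R * (p n ^+ k * n%:R)^-1.
have xge (A : R) : \forall n \near \oo, A <= p n ^+ k * n%:R.
  by move/cvgryPge: hpoo.
have xgt0 : \forall n \near \oo, 0 < p n ^+ k * n%:R.
  by near=> n; apply: (@lt_le_trans _ _ 1) => //; near: n; exact: xge.
have w_cvg : w n @[n --> \oo] --> (0 : R).
  by rewrite -[X in _ --> X](mulr0 (2 * k.+1)%:R); apply: cvgMr; apply/gtr0_cvgV0.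
have w01 : \forall n \near \oo, 0 <= w n <= 1.
  near=> n; have x0 : 0 < p n ^+ k * n%:R by near: n.
  rewrite /w mulr_ge0 ?invr_ge0 ?(ltW x0) //= ler_pdivrMr // mul1r.
  by near: n; exact: xge.
have large : \forall n \near \oo, (2 * k.+1)%:R <= w n * (p n ^+ k * n%:R).
  near=> n; have x0 : 0 < p n ^+ k * n%:R by near: n.
  by rewrite /w divfK ?gt_eqF.
have mu_gt0 : \forall n \near \oo, 0 < mu n.
  near=> n; have x0 : 0 < p n ^+ k * n%:R by near: n.
  have wn : 0 <= w n <= 1 by near: n.
  have ln : (2 * k.+1)%:R <= w n * (p n ^+ k * n%:R) by near: n.
  have nk := np_large_card (hp n) wn ln.
  have pn : 0 < p n.
    rewrite lt_def; have /andP[-> _] := hp n; rewrite andbT.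
    (* As k >= 1, p = 0 would give p^k n = 0. *)
    by apply: contraTneq x0 => ->; rewrite expr0n eqn0Ngt hk mul0r ltxx.
  by rewrite /mu Ex_f // mulr_gt0 ?exprn_gt0 // ltr0n bin_gt0; lia.
pose r n : R := p n ^+ k.+1 * n%:R + w n.
have r_cvg : r n @[n --> \oo] --> (0 : R).
  by rewrite -[X in _ --> X](addr0 0); apply: cvgD.
have fb_le : \forall n \near \oo,
    (1 - r n) * mu n <= Ex (p n) (@beta_ R n k) <= mu n.
  near=> n.
  have wn : 0 <= w n <= 1 by near: n.
  have ln : (2 * k.+1)%:R <= w n * (p n ^+ k * n%:R) by near: n.
  apply/andP; split; last first.
    by apply: ler_Ex => // G; rewrite ler_nat betti_le_face_count.
  have := Ex_f_sub_beta (hp n) wn ln; rewrite ExB -/(mu n) -/(r n).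
  by rewrite mulrBl mul1r lerBlDr lerBlDl addrC.
(* All three equivalences reduce to placing both variables in one window around [mu n] on the
   concentration event. The lower margin is 2 delta: one for the deviation of f_k, one for f_k -
   beta_k. *)
have sim (X Y : forall n, graph n -> R) :
    (forall delta : R, 0 < delta -> \forall n \near \oo, forall G : graph n,
      `|f_ R k G - mu n| <= delta * mu n ->
      f_ R k G - beta_ R k G <= delta * mu n ->
      ((1 - 2 * delta) * mu n <= X n G <= (1 + delta) * mu n) /\
      ((1 - 2 * delta) * mu n <= Y n G <= (1 + delta) * mu n)) ->
    sim_aa p X Y.
  move=> XY eps eps0.
  (* Ensures both delta <= 1/10 and 10 delta <= eps, as [ratio_close] requires. *)
  pose delta : R := Num.min eps 1 / 10.
  have m0 : 0 < Num.min eps 1 by rewrite lt_min eps0 ltr01.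
  have m1 : Num.min eps 1 <= 1 by rewrite ge_min lexx orbT.
  have me : Num.min eps 1 <= eps by rewrite ge_min lexx.
  have d0 : 0 < delta by rewrite /delta; lra.
  have d1 : delta <= 10^-1 by rewrite /delta; lra.
  have de : 10 * delta <= eps by rewrite /delta; lra.
  have XYd := XY _ d0.
  apply: (@squeeze_cvgr _ _ _ _
    (fun n => 1 - (2 ^+ k.+1 * w n / delta ^+ 2 + r n / delta)) (fun=> 1)).
  - near=> n; rewrite Pr_le1 // andbT.
    have wn : 0 <= w n <= 1 by near: n.
    have ln : (2 * k.+1)%:R <= w n * (p n ^+ k * n%:R) by near: n.
    have mun : 0 < mu n by near: n.
    apply: le_trans (Pr_concentration (hp n) wn ln d0 mun) _.
    apply: sub_Pr => // G /andP[h1 h2].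
    have [] // := near XYd n _ G h1 h2.
    by move=> hX hY; apply: ratio_close mun _ de hX hY; rewrite d0.
  - rewrite -[X in _ --> X]subr0; apply: cvgB; first exact: cvg_cst.
    rewrite -[X in _ --> X](addr0 0); apply: cvgD.
      rewrite -[X in _ --> X](mul0r (delta ^- 2)); apply: cvgMl.
      by rewrite -[X in _ --> X](mulr0 (2 ^+ k.+1)); apply: cvgMr.
    by rewrite -[X in _ --> X](mul0r (delta ^-1)); apply: cvgMl.
  - exact: cvg_cst.
have f_close n delta (G : graph n) : 0 < delta -> 0 < mu n ->
    `|f_ R k G - mu n| <= delta * mu n ->
    (1 - 2 * delta) * mu n <= f_ R k G <= (1 + delta) * mu n.
  move=> d0 m0; rewrite ler_distl => /andP[h1 h2]; apply/andP; split; nra.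
have b_close n delta (G : graph n) : 0 < delta -> 0 < mu n ->
    `|f_ R k G - mu n| <= delta * mu n ->
    f_ R k G - beta_ R k G <= delta * mu n ->
    (1 - 2 * delta) * mu n <= beta_ R k G <= (1 + delta) * mu n.
  move=> d0 m0; rewrite ler_distl => /andP[h1 h2] h3.
  have h4 : beta_ R k G <= f_ R k G by rewrite ler_nat betti_le_face_count.
  apply/andP; split; nra.
split.
- apply: (@squeeze_cvgr _ _ _ _ (fun n => 1 - r n) (fun=> 1)).
  + near=> n; have mun : 0 < mu n by near: n.
    rewrite ler_pdivlMr // ler_pdivrMr // mul1r.
    by near: n.
  + by rewrite -[X in _ --> X]subr0; apply: cvgB => //; exact: cvg_cst.
  + exact: cvg_cst.
- apply: sim => delta d0; near=> n => G h1 h2.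
  have mun : 0 < mu n by near: n.
  split; first exact: b_close.
  (* Puts E(beta_k), at least (1 - r) mu by [fb_le], inside the same window. *)
  have rn : r n <= delta by near: n; apply: cvgr_le r_cvg _ d0.
  have /andP[e1 e2] : (1 - r n) * mu n <= Ex (p n) (@beta_ R n k) <= mu n.
    by near: n.
  apply/andP; split; nra.
- apply: sim => delta d0; near=> n => G h1 h2.
  have mun : 0 < mu n by near: n.
  split; first exact: f_close.
  rewrite -/(mu n); apply/andP; split; nra.
- apply: sim => delta d0; near=> n => G h1 h2.
  have mun : 0 < mu n by near: n.
  by split; [exact: b_close | exact: f_close].
Unshelve. all: by end_near.
Qed.
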